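(* Let $K$ be a field, let $r,k,d$ be positive integers, let $R=K[x_1,\dots,x_r]$, and let $I_{r,k,d}\subset R$ be the monomial ideal $(x_1^k,x_2^k,\dots,x_r^k)+(\text{all squarefree monomials of degree } d)$. Consider the ring $R/I_{r,k,d}$. (a) If $d=2$, then it has the Weak Lefschetz property. (b) Let $d=3$ and $k\ge 2$. Then: (i) if $K$ has characteristic two, then $R/I_{r,k,d}$ does not have the Weak Lefschetz property; (ii) if the characteristic of $K$ is not two, then $R/I_{r,k,d}$ has the Weak Lefschetz property if and only if $k$ is even.
   Context: A standard graded Artinian $K$-algebra $A$ has the Weak Lefschetz property (WLP) if there is a linear form $L\in A_1$ such that for all integers $j$ the multiplication map $\times L: A_{j-1}\to A_j$ has maximal rank, i.e. is injective or surjective.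
   Formalization: Part (b) is proved for r ≥ 3 only; for r ≤ 2 there are no squarefree monomials of degree 3, the ring is K[x]/(x^k) or K[x,y]/(x^k,y^k), which always has the Weak Lefschetz property, so (b)(i) and, for odd k, (b)(ii) are false. *)

(* Defs.v *)
From HB Require Import structures.
From mathcomp Require Import all_boot all_order all_algebra ring_quotient.
From mathcomp Require Import boolp.
From mathcomp Require Import mpoly.

Set Implicit Arguments.
Unset Strict Implicit.
Unset Printing Implicit Defensive.

Import GRing.Theory.
Local Open Scope ring_scope.
Local Open Scope quotient_scope.

(* The ideal generated by the set G: finite sums of terms u * g with g in G.
   Membership is made boolean, as [idealr] requires, by classical logic. *)
Definition ideal_gen (R : comNzRingType) (G : R -> Prop) (f : R) : bool :=
  `[< exists s : seq (R * R),
        (forall c, c \in s -> G c.2) /\ f = \sum_(c <- s) c.1 * c.2 >].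

Definition squarefree_mnm (r : nat) (m : 'X_{1..r}) : Prop :=
  forall i : 'I_r, (m i <= 1)%N.

Definition power_squarefree_gens (K : fieldType) (r k d : nat)
    (g : {mpoly K[r]}) : Prop :=
  (exists i : 'I_r, g = 'X_i ^+ k)
  \/ (exists m : 'X_{1..r}, [/\ squarefree_mnm m, mdeg m = d & g = 'X_[m]]).

Section PowerSquarefreeIdeal.

Variables (K : fieldType) (r k d : nat).

Lemma power_squarefree_gens_closed (k_gt0 : (0 < k)%N) (d_gt0 : (0 < d)%N) :
  idealr_closed
    (ideal_gen (@power_squarefree_gens K r k d) : {pred {mpoly K[r]}}).
Proof.
split.
- by apply/asboolP; exists [::]; rewrite big_nil.
- apply/asboolP=> -[s [sG /(congr1 (mcoeff 0%MM))]].
  rewrite mcoeff1 eqxx raddf_sum big1_seq => [/eqP|c /= c_s].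
    by rewrite oner_eq0.
  rewrite rmorphM /=; case: (sG c c_s) => [[i ->]|[m [_ degm ->]]].
    by rewrite rmorphXn /= mcoeffX mnm1_eq0 expr0n eqn0Ngt k_gt0 mulr0.
  by rewrite mcoeffX -mdeg_eq0 degm eqn0Ngt d_gt0 mulr0.
- move=> a u v /asboolP[su [suG ->]] /asboolP[sv [svG ->]]; apply/asboolP.
  exists ([seq (a * c.1, c.2) | c <- su] ++ sv); split=> [c|].
    by rewrite mem_cat => /orP[/mapP[c' /suG + ->]|/svG].
  rewrite big_cat big_map mulr_sumr; congr (_ + _).
  by apply: eq_bigr => c _ /=; rewrite mulrA.
Qed.

(* (x_1^k, ..., x_r^k) + (all squarefree monomials of degree d); positivity of
   k and d makes it proper, as [idealr] requires. *)
Definition power_squarefree_ideal (k_gt0 : (0 < k)%N) (d_gt0 : (0 < d)%N) :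
    idealr {mpoly K[r]} :=
  HB.pack_for (idealr {mpoly K[r]})
    (ideal_gen (@power_squarefree_gens K r k d))
    (isIdealr.Build {mpoly K[r]} (ideal_gen (@power_squarefree_gens K r k d))
       (power_squarefree_gens_closed k_gt0 d_gt0)).

End PowerSquarefreeIdeal.

Arguments power_squarefree_ideal K r {k d}.

Definition graded_piece (K : fieldType) (r : nat) (I : idealr {mpoly K[r]})
    (j : nat) (a : {ideal_quot I}) : Prop :=
  exists2 f : {mpoly K[r]}, f \is j.-homog & a = \pi_{ideal_quot I} f.

(* Weak Lefschetz property of {mpoly K[r]} / I, for I a homogeneous ideal.
   The maps A_(j-1) -> A_j with j <= 0 start from the zero space and are
   injective, so it suffices to consider A_j -> A_(j+1) for j : nat. *)
Definition weak_lefschetz (K : fieldType) (r : nat)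
    (I : idealr {mpoly K[r]}) : Prop :=
  exists2 L : {ideal_quot I}, graded_piece 1 L &
    forall j : nat,
      (forall a b : {ideal_quot I}, graded_piece j a -> graded_piece j b ->
         L * a = L * b -> a = b)
      \/ (forall b : {ideal_quot I}, graded_piece j.+1 b ->
            exists2 a : {ideal_quot I}, graded_piece j a & L * a = b).

(* Main.v *)
(** The monomials with all exponents < k and fewer than d variables form a basis
    of A = R/I. For d = 2 and L the sum of the variables, L sends x_i^j to
    x_i^(j+1) and everything is immediate. For d = 3 the basis consists of the
    x_i^p x_l^q. With the same L, a kernel element has coefficients alternating
    in sign along each line p + q = j, so for j < k it vanishes as soon as its
    coefficients c_i at the x_i^j do; in the critical degree j = k - 1 these
    satisfy only c_i = (-1)^(k-1) c_l, which forces c = 0 when k is even, 2 <> 0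
    and r >= 3. For j >= k, L is onto because
    x_i^p x_l^q = L x_i^(p-1) x_l^q - x_i^(p-1) x_l^(q+1) and x_l^k = 0.
    If (-1)^(k-1) = 1 in K, every L = sum_i a_i x_i fails in degree k - 1: the
    form sum_m (+-1) a^m x^m over the basis monomials of degree k - 1 is killed
    by L, and an alternating functional on a triangle of variables kills the
    image of L. *)
Require Import Defs.
From mathcomp Require Import all_boot all_order all_algebra ring_quotient mpoly.
From mathcomp Require Import boolp ring zify.

Section LinearForms.

Set Implicit Arguments.
Unset Strict Implicit.
Unset Printing Implicit Defensive.

Import GRing.Theory.
Local Open Scope ring_scope.
Local Open Scope quotient_scope.

Variables (K : fieldType) (r : nat).
Implicit Types (a : 'I_r -> K) (f g : {mpoly K[r]}) (m : 'X_{1..r}).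

(** * Linear forms and the coefficients of their multiples *)

Definition linear_form a : {mpoly K[r]} := \sum_i a i *: 'X_i.

Lemma mcoeffMX_nle f m m' : ~~ (m <= m')%MM -> (f * 'X_[m])@_m' = 0.
Proof.
move=> /negP m_nle; rewrite mcoeffM big1 // => -[h1 h2] /= /eqP m'E.
rewrite mcoeffX; case: eqP => [mE|_]; last by rewrite mulr0.
by case: m_nle; rewrite m'E mE; apply: lem_addl.
Qed.

Lemma mcoeff_mulXU f i m :
  ('X_i * f)@_m = if (0 < m i)%N then f@_(m - U_(i))%MM else 0.
Proof.
rewrite mulrC; case: ifP => m_i.
  by rewrite -(mcoeffMX f U_(i)) addmC submK // lep1mP -lt0n.
by rewrite mcoeffMX_nle // lep1mP -lt0n m_i.
Qed.

Lemma mcoeff_linear_formM a f m :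
  (linear_form a * f)@_m =
  \sum_(i | (0 < m i)%N) a i * f@_(m - U_(i))%MM.
Proof.
rewrite /linear_form mulr_suml raddf_sum /= [RHS]big_mkcond /=.
apply: eq_bigr => i _; rewrite -scalerAl mcoeffZ mcoeff_mulXU.
by case: ifP; rewrite // mulr0.
Qed.

Lemma linear_form_homog a : linear_form a \is 1.-homog.
Proof.
by apply: rpred_sum => i _; apply: rpredZ; rewrite dhomogX /= mdeg1.
Qed.

Lemma homog1_linear_form f : f \is 1.-homog -> exists a, f = linear_form a.
Proof.
move=> f_homog; exists (fun i => f@_U_(i)); apply/mpolyP => m.
rewrite /linear_form raddf_sum /=.
have [/mdeg1P[i /eqP->]|m_deg] := boolP (mdeg m == 1%N).
  rewrite (bigD1 i) //= mcoeffZ mcoeffXU eqxx mulr1 big1 ?addr0 // => j jNi.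
  by rewrite mcoeffZ mcoeffXU (negPf jNi) mulr0.
rewrite (dhomog_nemf_coeff f_homog) // big1 // => i _.
rewrite mcoeffZ mcoeffX; case: eqP => [mE|_]; last by rewrite mulr0.
by rewrite -mE mdeg1 in m_deg.
Qed.

(** * The Weak Lefschetz property on polynomial representatives *)

Section Ideal.

Variable I : idealr {mpoly K[r]}.

Definition injective_at a j := forall f,
  f \is j.-homog -> linear_form a * f \in I -> f \in I.

Definition surjective_at a j := forall g, g \is j.+1.-homog ->
  exists2 f, f \is j.-homog & linear_form a * f - g \in I.

Lemma pi_eqP f g :
  reflect (\pi_{ideal_quot I} f = \pi_{ideal_quot I} g) (f - g \in I).
Proof. by rewrite Quotient.idealrBE; apply: eqP. Qed.

(** Classes are replaced by homogeneous representatives. A difference of forms of equal degree is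
    again homogeneous, so injectivity reduces to a trivial kernel. *)
Lemma weak_lefschetzP : weak_lefschetz I <->
  exists a, forall j, injective_at a j \/ surjective_at a j.
Proof.
have pi0 : 0 = \pi_{ideal_quot I} 0 by rewrite rmorph0.
split=> [[L [_ /homog1_linear_form[a ->] ->] wlp]|[a wlp]].
  exists a => j; case: (wlp j) => [inj|surj]; [left|right].
    move=> f f_homog Lf_I.
    suff /pi_eqP : \pi_{ideal_quot I} f = \pi 0 by rewrite subr0.
    apply: inj; [by exists f | by exists 0; rewrite ?dhomog0 |].
    by rewrite -!rmorphM; apply/pi_eqP; rewrite mulr0 subr0.
  move=> g g_homog; have [|_ [f f_homog ->] LfE] := surj (\pi g).
    by exists g.
  by exists f => //; apply/pi_eqP; rewrite rmorphM.
exists (\pi_{ideal_quot I} (linear_form a)).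
  by exists (linear_form a) => //; apply: linear_form_homog.
move=> j; case: (wlp j) => [inj|surj]; [left|right].
  move=> _ _ [f f_homog ->] [g g_homog ->]; rewrite -!rmorphM => /pi_eqP.
  rewrite -mulrBr => L_I; apply/pi_eqP; apply: inj => //.
  by rewrite rpredB.
move=> _ [g g_homog ->]; have [f f_homog /pi_eqP LfE] := surj _ g_homog.
by exists (\pi f); [exists f | rewrite -rmorphM].
Qed.

Lemma surjective_at_monomials a j :
  (forall m, mdeg m = j.+1 ->
     exists2 f, f \is j.-homog & linear_form a * f - 'X_[m] \in I) ->
  surjective_at a j.
Proof.
move=> surjX g g_homog; rewrite [g]mpolyE big_seq.
apply: (big_ind (fun g => exists2 f, f \is j.-homog &
                          linear_form a * f - g \in I)).
- by exists 0; rewrite ?dhomog0 // mulr0 subr0 idealr0.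
- move=> g1 g2 [f1 f1_homog Lf1] [f2 f2_homog Lf2].
  exists (f1 + f2); first by rewrite rpredD.
  by rewrite mulrDr opprD addrACA rpredD.
move=> m m_g; have [|f f_homog Lf] := surjX m.
  by rewrite (dhomog_mf g_homog m_g).
exists (g@_m *: f); first by rewrite rpredZ.
by rewrite -scalerAr -scalerBr -mul_mpolyC idealMr.
Qed.

End Ideal.

(** Supplies the kernel element that refutes injectivity, which is known only through its
    coefficients. *)
Lemma exists_homog_mcoeff (j : nat) (u : 'X_{1..r} -> K) :
  exists2 f, f \is j.-homog & forall m, mdeg m = j -> f@_m = u m.
Proof.
exists (\sum_(m : 'X_{1..r < j.+1} | mdeg m == j) u m *: 'X_[m]).
  by apply: rpred_sum => m m_j; rewrite rpredZ // dhomogX.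
move=> m m_j; rewrite big_mkcond /=.
rewrite (eq_bigr (fun m' : 'X_{1..r < j.+1} =>
    (if mdeg m' == j then u m' else 0) *: 'X_[m'])).
  by rewrite (mcoeff_mpoly (fun m => if mdeg m == j then u m else 0));
    rewrite m_j ?eqxx.
by move=> m' _; case: ifP; rewrite ?scale0r.
Qed.

(** * Standard monomials and membership in the ideal *)

Definition standard (k d : nat) m :=
  [forall i, (m i < k)%N] && (#|[set i | 0 < m i]| < d)%N.

Section Membership.

Variables (k d : nat) (k_gt0 : (0 < k)%N) (d_gt0 : (0 < d)%N).
Local Notation I := (power_squarefree_ideal K r k_gt0 d_gt0).

Lemma power_squarefree_gen_mem g : power_squarefree_gens k d g -> g \in I.
Proof.
move=> g_gen; apply/asboolP; exists [:: (1, g)]; rewrite big_seq1 mul1r.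
by split=> // c; rewrite inE => /eqP->.
Qed.

Lemma standard_mnmXPn m : ~~ standard k d m -> 'X_[m] \in I.
Proof.
move=> m_nstd; suff [n [n_gen n_m]] : exists n,
    power_squarefree_gens k d 'X_[K, n] /\ (n <= m)%MM.
  by rewrite -(submK n_m) mpolyXD idealMr // power_squarefree_gen_mem.
move: m_nstd; rewrite negb_and -leqNgt => /orP[/forallPn[i]|].
  rewrite -leqNgt => k_mi; exists (U_(i) *+ k)%MM; split.
    by left; exists i; rewrite mpolyXn.
  apply/mnm_lepP => i'; rewrite mulmnE mnm1E.
  by case: eqP => [<-|]; rewrite ?mul1n.
(* The product of [d] distinct variables occurring in [m] is a generator dividing it. *)
case/card_geqP => s [s_uniq s_size s_m].
exists [multinom (i \in s : nat) | i < r].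
split; last first.
  apply/mnm_lepP => i; rewrite mnmE.
  by case: (boolP (i \in s)) => // /s_m; rewrite inE.
right; exists [multinom (i \in s : nat) | i < r]; split=> //.
  by move=> i; rewrite mnmE leq_b1.
rewrite mdegE -s_size -(card_uniqP s_uniq) -sum1_card [RHS]big_mkcond /=.
by apply: eq_bigr => i _; rewrite mnmE; case: ifP.
Qed.

(** No generator divides a standard monomial, and every other monomial lies in [I]. *)
Lemma power_squarefree_idealP f :
  reflect (forall m, standard k d m -> f@_m = 0) (f \in I).
Proof.
apply: (iffP idP) => [/asboolP[s [s_gen ->]] m /andP[/forallP m_k m_d]|f0].
  rewrite raddf_sum big1_seq //= => c /s_gen[[i ->]|[n [n_sqf n_d ->]]].
    rewrite mpolyXn mcoeffMX_nle //; apply/mnm_lepP => /(_ i).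
    by rewrite mulmnE mnm1E eqxx mul1n leqNgt m_k.
  rewrite mcoeffMX_nle //; apply/negP => /mnm_lepP n_m.
  (* The degree of a squarefree [n] is the size of its support, which would sit inside the support
     of [m]. *)
  move: m_d; rewrite ltnNge -n_d mdegE -sum1_card [leqRHS]big_mkcond /=.
  case/negP; apply: leq_sum => i _; rewrite inE; move: (n_sqf i) (n_m i).
  by case: (n i) => [|[|]] //= _ ->.
rewrite [f]mpolyE big_seq rpred_sum // => m m_f.
have [/f0 ->|m_nstd] := boolP (standard k d m); first by rewrite scale0r rpred0.
by rewrite -mul_mpolyC idealMr // standard_mnmXPn.
Qed.

End Membership.


(** * Monomials in at most two variables *)

Definition pair_mnm (i l : 'I_r) (p q : nat) : 'X_{1..r} :=
  (U_(i) *+ p + U_(l) *+ q)%MM.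

Lemma pair_mnmE i l p q x :
  pair_mnm i l p q x = ((i == x) * p + (l == x) * q)%N.
Proof. by rewrite mnmDE !mulmnE !mnm1E. Qed.

Lemma pair_mnm_l i l p q : i != l -> pair_mnm i l p q i = p.
Proof.
by move=> iNl; rewrite pair_mnmE eqxx eq_sym (negPf iNl) mul1n addn0.
Qed.

Lemma pair_mnm_r i l p q : i != l -> pair_mnm i l p q l = q.
Proof. by move=> iNl; rewrite pair_mnmE eqxx (negPf iNl) mul1n. Qed.

Lemma pair_mnmp0 i l p : pair_mnm i l p 0 = (U_(i) *+ p)%MM.
Proof. by rewrite /pair_mnm mulm0n addm0. Qed.

Lemma pair_mnm0q i l q : pair_mnm i l 0 q = (U_(l) *+ q)%MM.
Proof. by rewrite /pair_mnm mulm0n add0m. Qed.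

Lemma mdeg_pair_mnm i l p q : mdeg (pair_mnm i l p q) = (p + q)%N.
Proof. by rewrite mdegD !mdegMn !mdeg1 !mul1n. Qed.

(** Only two variables divide the monomial, so two terms survive; this is the recurrence along the
    line where [p + q] is constant. *)
Lemma mcoeff_linear_formM_pair a f i l p q : i != l ->
  (linear_form a * f)@_(pair_mnm i l p.+1 q.+1) =
  a i * f@_(pair_mnm i l p q.+1) + a l * f@_(pair_mnm i l p.+1 q).
Proof.
move=> iNl; rewrite mcoeff_linear_formM (bigD1 i) /=; last first.
  by rewrite pair_mnm_l.
rewrite (bigD1 l) /=; last by rewrite pair_mnm_r // eq_sym iNl.
rewrite big1 ?addr0 => [|x /andP[/andP[]]]; last first.
  rewrite pair_mnmE => + xNi xNl.
  by rewrite ![_ == x]eq_sym (negPf xNi) (negPf xNl).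
congr (_ * f@__ + _ * f@__); apply/mnmP => x; rewrite mnmBE mnm1E !pair_mnmE.
  by case: (i == x) => /=; case: (l == x) => /=; lia.
by case: (i == x) => /=; case: (l == x) => /=; lia.
Qed.

Lemma mcoeff_linear_formM_power a f i p :
  (linear_form a * f)@_(U_(i) *+ p.+1)%MM = a i * f@_(U_(i) *+ p)%MM.
Proof.
rewrite mcoeff_linear_formM (bigD1 i) /=; last by rewrite mulmnE mnm1E eqxx.
rewrite big1 ?addr0 => [|x /andP[]]; last first.
  by rewrite mulmnE mnm1E eq_sym => + /negPf xNi; rewrite xNi.
congr (_ * f@__); apply/mnmP => x; rewrite mnmBE !mulmnE mnm1E.
by case: (i == x) => /=; lia.
Qed.

Lemma standard_power k d i p : (1 < d)%N -> (p < k)%N ->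
  standard k d (U_(i) *+ p)%MM.
Proof.
move=> d_gt1 p_k; apply/andP; split.
  apply/forallP => x; rewrite mulmnE mnm1E.
  by case: (i == x) => /=; lia.
have card1 := cards1 i; apply: leq_ltn_trans d_gt1.
rewrite -[leqRHS]card1 subset_leq_card //.
apply/subsetP => x; rewrite !inE mulmnE mnm1E eq_sym.
by case: (x == i).
Qed.

Lemma standard_pair k d i l p q : (2 < d)%N -> i != l ->
  (p < k)%N -> (q < k)%N -> standard k d (pair_mnm i l p q).
Proof.
move=> d_gt2 iNl p_k q_k; apply/andP; split.
  apply/forallP => x; rewrite pair_mnmE.
  case: (eqVneq i x) => [<-|_]; first by rewrite eq_sym (negPf iNl) /=; lia.
  by case: (l == x) => /=; lia.
have card2 : #|[set i; l]| = 2%N by rewrite cards2 iNl.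
apply: leq_ltn_trans d_gt2; rewrite -[leqRHS]card2 subset_leq_card //.
apply/subsetP => x; rewrite !inE pair_mnmE ![x == _]eq_sym.
by case: (i == x); case: (l == x).
Qed.

Lemma standard2_power k m : (0 < r)%N -> standard k 2 m ->
  exists i, m = (U_(i) *+ m i)%MM.
Proof.
move=> r_gt0 /andP[_]; rewrite ltnS => m_1.
have [i supp_i] : exists i, [set x | (0 < m x)%N] \subset [set i].
  case: (posnP #|[set x | (0 < m x)%N]|) => [/eqP|card_gt0].
    by rewrite cards_eq0 => /eqP->; exists (Ordinal r_gt0); apply: sub0set.
  have /cards1P[i ->] : #|[set x | (0 < m x)%N]| == 1%N by lia.
  by exists i.
exists i; apply/mnmP => x; rewrite mulmnE mnm1E.
case: eqP => [<-|iNx]; first by rewrite mul1n.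
rewrite mul0n; apply/eqP; rewrite -leqn0 leqNgt; apply/negP => m_x.
by have /(subsetP supp_i) : x \in [set x | (0 < m x)%N];
  rewrite !inE // => /eqP xi; apply: iNx.
Qed.

Lemma neq_ord (i : 'I_r) : (1 < r)%N -> exists l, i != l.
Proof.
move=> r_gt1; have /card_gt0P[l] : (0 < #|predC1 i|)%N.
  by rewrite cardC1 card_ord; lia.
by rewrite !inE eq_sym; exists l.
Qed.

(** A support with fewer than two variables is padded by arbitrary ones, whose exponent is 0. *)
Lemma standard3_pair k m : (1 < r)%N -> standard k 3 m ->
  exists i l, i != l /\ m = pair_mnm i l (m i) (m l).
Proof.
move=> r_gt1 /andP[_]; rewrite ltnS => m_2.
have [i [l [iNl supp_il]]] :
    exists i l, i != l /\ [set x | (0 < m x)%N] \subset [set i; l].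
  case: (posnP #|[set x | (0 < m x)%N]|) => [/eqP|card_gt0].
    rewrite cards_eq0 => /eqP->.
    have [l iNl] := neq_ord (Ordinal (ltnW r_gt1)) r_gt1.
    by exists (Ordinal (ltnW r_gt1)), l; split => //; apply: sub0set.
  case: (#|[set x | (0 < m x)%N]| =P 1%N) => [/eqP/cards1P[i ->]|card_neq1].
    by have [l iNl] := neq_ord i r_gt1; exists i, l;
      rewrite iNl sub1set !inE eqxx.
  have /finset.cards2P[i [l [iNl ->]]] : #|[set x | (0 < m x)%N]| == 2%N by lia.
  by exists i, l.
exists i, l; split=> //; apply/mnmP => x; rewrite pair_mnmE.
case: (eqVneq i x) iNl => [<-|iNx] iNl.
  by rewrite eq_sym (negPf iNl) mul1n addn0.
case: (eqVneq l x) => [<-|lNx]; first by rewrite mul1n.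
rewrite !mul0n; apply/eqP; rewrite -leqn0 leqNgt; apply/negP => m_x.
have /(subsetP supp_il) : x \in [set x | (0 < m x)%N] by rewrite inE.
by rewrite !inE ![x == _]eq_sym (negPf iNx) (negPf lNx).
Qed.

(** * Multiplication maps for [d = 2] *)

Section Maps.

Variables (k d : nat) (k_gt0 : (0 < k)%N) (d_gt0 : (0 < d)%N).
Local Notation I := (power_squarefree_ideal K r k_gt0 d_gt0).
Local Notation sum_vars := (linear_form (fun=> 1)).

Lemma injective_at2 j : (0 < r)%N -> d = 2%N -> (j.+1 < k)%N ->
  injective_at I (fun=> 1) j.
Proof.
move=> r_gt0 dE j_k f f_homog /power_squarefree_idealP Lf0.
apply/power_squarefree_idealP => m; rewrite dE.
case/(standard2_power r_gt0) => i mE.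
have [m_j|] := eqVneq (mdeg m) j; last exact: dhomog_nemf_coeff.
have {mE}-> : m = (U_(i) *+ j)%MM.
  by rewrite -m_j {2}mE mdegMn mdeg1 mul1n.
have := Lf0 (U_(i) *+ j.+1)%MM; rewrite mcoeff_linear_formM_power mul1r.
by apply; apply: standard_power; rewrite ?dE.
Qed.

(** The target is zero: standard monomials are pure powers of degree below [k]. *)
Lemma surjective_at2 a j : (0 < r)%N -> d = 2%N -> (k <= j.+1)%N ->
  surjective_at I a j.
Proof.
move=> r_gt0 dE k_j; apply: surjective_at_monomials => m m_j.
exists 0; rewrite ?dhomog0 // mulr0 sub0r rpredN standard_mnmXPn //.
rewrite dE; apply/negP => m_std; have [i mE] := standard2_power r_gt0 m_std.
have /andP[/forallP/(_ i) m_i _] := m_std.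
by move: m_j; rewrite mE mdegMn mdeg1 mul1n; lia.
Qed.

(** * The sum of the variables for [d = 3] *)

Lemma mcoeff_pair_alternate f j i l p q : (2 < d)%N -> i != l ->
  (j < k)%N -> (p + q = j)%N -> sum_vars * f \in I ->
  f@_(pair_mnm i l p q) = (-1) ^+ p * f@_(U_(l) *+ j)%MM.
Proof.
move=> d_gt2 iNl j_k + /power_squarefree_idealP Lf0.
elim: p q => [|p IHp] q pqE; first by rewrite pair_mnm0q mul1r -pqE.
(* Both exponents are at most [j < k], so this monomial is standard and the two neighbouring
   coefficients of [f] are opposite. *)
have := Lf0 (pair_mnm i l p.+1 q.+1).
rewrite mcoeff_linear_formM_pair // !mul1r.
rewrite addrC => /(_ _)/eqP; rewrite addr_eq0 => fE.
rewrite (eqP (fE _)); last by apply: standard_pair => //; lia.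
by rewrite IHp ?exprS ?mulN1r ?mulNr //; lia.
Qed.

Lemma injective_at3 j : (2 < r)%N -> d = 3%N -> ~~ odd k ->
  2%:R != 0 :> K -> (j < k)%N -> injective_at I (fun=> 1) j.
Proof.
move=> r_gt2 dE k_even two_neq0 j_k f f_homog Lf_I.
have alt i l p q := @mcoeff_pair_alternate f j i l p q.
have f_pow i : f@_(U_(i) *+ j)%MM = 0.
  have [j1_k|k_j1] := ltnP j.+1 k.
    move/power_squarefree_idealP: Lf_I => /(_ (U_(i) *+ j.+1)%MM).
    rewrite mcoeff_linear_formM_power mul1r; apply.
    by apply: standard_power; rewrite ?dE.
  (* Now [j = k - 1] is odd, so the alternation ends with the opposite sign. *)
  have opp x y : x != y -> f@_(U_(x) *+ j)%MM = - f@_(U_(y) *+ j)%MM.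
    move=> xNy; rewrite -(pair_mnmp0 x y) alt ?dE ?addn0 //.
    have jE : j = k.-1 by lia.
    by rewrite -signr_odd (_ : odd j) ?mulN1r //; lia.
  (* Three sign changes around a triangle of variables make the coefficient at [i] its own
     opposite. *)
  have [x [iNx [y [yNi yNx]]]] : exists x, i != x /\ exists y, y != i /\ y != x.
    have [x iNx] := neq_ord i (ltnW r_gt2); exists x; split=> //.
    have : (0 < #|~: [set i; x]|)%N.
      by rewrite cardsCs setCK cards2 iNx card_ord; lia.
    by case/card_gt0P=> y; rewrite !inE negb_or => /andP[yNi yNx]; exists y.
  have := opp _ _ iNx; rewrite (opp x y) 1?eq_sym // (opp y i) // opprK.
  move/eqP; rewrite -addr_eq0 -mulr2n -mulr_natl mulf_eq0 (negPf two_neq0) /=.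
  by move/eqP.
apply/power_squarefree_idealP => m; rewrite dE => m_std.
have [i [l [iNl mE]]] := standard3_pair (ltnW r_gt2) m_std.
have [m_j|] := eqVneq (mdeg m) j; last exact: dhomog_nemf_coeff.
rewrite mE alt ?dE // ?f_pow ?mulr0 //.
by rewrite -m_j {3}mE mdeg_pair_mnm.
Qed.

(** Induction on [k - q]: modulo [I] and the image, the exponent moves from [i] to [l] until it
    reaches [k]. *)
Lemma pair_mnmX_in_image j i l p q : d = 3%N -> i != l -> (k <= j)%N ->
  (p + q = j.+1)%N -> (0 < p)%N -> (0 < q)%N ->
  exists2 f, f \is j.-homog & sum_vars * f - 'X_[pair_mnm i l p q] \in I.
Proof.
move=> dE iNl k_j; have [n] := ubnP (k - q).
elim: n p q => // n IHn p q q_n pqE p_gt0 q_gt0.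
have [k_q|q_k] := leqP k q.
  exists 0; rewrite ?dhomog0 // mulr0 sub0r rpredN standard_mnmXPn //.
  apply/negP => /andP[/forallP/(_ l)]; rewrite pair_mnm_r //; lia.
(* Since [q < k <= j], [p] is at least 2 and [p.-1] stays positive. *)
have [||||f f_homog Lf_I] := IHn p.-1 q.+1; try lia.
exists ('X_[pair_mnm i l p.-1 q] - f).
  by rewrite rpredB // dhomogX /= mdeg_pair_mnm; apply/eqP; lia.
rewrite mulrBr; set Lf := _ * f in Lf_I *.
rewrite /linear_form (bigD1 i) // (bigD1 l) 1?eq_sym // !mulrDl.
rewrite !scale1r -!mpolyXD (_ : _ + _ = pair_mnm i l p q)%MM; last first.
  apply/mnmP => x; rewrite mnmDE mnm1E !pair_mnmE.
  by case: (i == x) => /=; lia.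
rewrite (_ : U_(l) + _ = pair_mnm i l p.-1 q.+1)%MM; last first.
  apply/mnmP => x; rewrite mnmDE mnm1E !pair_mnmE.
  by case: (l == x) => /=; lia.
set others := \sum_(x | _) _.
set Xpq := 'X_[pair_mnm i l p q]; set Xnext := 'X_[_] in Lf_I *.
rewrite (_ : _ - Xpq = others * 'X_[pair_mnm i l p.-1 q] - (Lf - Xnext)).
  (* Any other variable [x] yields a monomial in three variables, which lies in [I]. *)
  rewrite rpredB // mulr_suml rpred_sum // => x /andP[/= xNi xNl].
  rewrite scale1r -mpolyXD standard_mnmXPn // dE; apply/negP => /andP[_].
  have -> : 3%N = #|x |: [set i; l]|.
    by rewrite cardsU1 cards2 iNl !inE negb_or xNi xNl.
  rewrite ltnNge subset_leq_card //; apply/subsetP => y.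
  rewrite !inE mnmDE mnm1E pair_mnmE ![y == _]eq_sym.
  by case: (x == y); case: (i == y); case: (l == y) => //=; lia.
by ring.
Qed.

Lemma surjective_at3 j : (1 < r)%N -> d = 3%N -> (k <= j)%N ->
  surjective_at I (fun=> 1) j.
Proof.
move=> r_gt1 dE k_j; apply: surjective_at_monomials => m m_j.
have [m_std|m_nstd] := boolP (standard k d m); last first.
  by exists 0; rewrite ?dhomog0 // mulr0 sub0r rpredN standard_mnmXPn.
have /andP[/forallP m_k _] := m_std.
rewrite dE in m_std; have [i [l [iNl mE]]] := standard3_pair r_gt1 m_std.
have := m_j; rewrite mE mdeg_pair_mnm => mil_j.
have := m_k i; have := m_k l => ml_k mi_k.
(* Both exponents are positive: their sum exceeds [k], while each is below [k]. *)
by apply: pair_mnmX_in_image => //; lia.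
Qed.

(** * Failure in degree [k - 1] for [d = 3] *)

Lemma not_injective_at3 a n : (1 < r)%N -> d = 3%N -> k = n.+1 ->
  (-1) ^+ n = 1 :> K -> (0 < n)%N -> ~ injective_at I a n.
Proof.
move=> r_gt1 dE kE signn n_gt0 inj.
have [/existsP[i a_i]|/existsPn a0] := boolP [exists i, a i != 0]; last first.
  (* The zero form kills the nonzero class of a pure power. *)
  pose i := Ordinal (ltnW r_gt1).
  have /power_squarefree_idealP/(_ (U_(i) *+ n)%MM) : 'X_[U_(i) *+ n] \in I.
    apply: inj; first by rewrite dhomogX /= mdegMn mdeg1 mul1n.
    rewrite /linear_form big1 ?mul0r ?idealr0 // => x _.
    by have := a0 x; rewrite negbK => /eqP->; rewrite scale0r.
  rewrite mcoeffX eqxx standard_power ?dE ?kE // => /(_ isT)/eqP.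
  by rewrite oner_eq0.
(* When n is odd the hypothesis forces -1 = 1 in K; when n is even the two
   exponents of a basis monomial of degree n have equal parity. Either way the
   sign flips, up to -1 = 1, along each line p + q = n. *)
pose u m := (-1) ^+ [exists x, odd (m x)] * \prod_x a x ^+ m x.
have [f f_homog fE] := exists_homog_mcoeff n u.
have prodE x y p q : \prod_z a z ^+ pair_mnm x y p q z = a x ^+ p * a y ^+ q.
  rewrite (eq_bigr (fun z => (if z == x then a x ^+ p else 1) *
                             (if z == y then a y ^+ q else 1))).
    by rewrite big_split /= -!big_mkcond !big_pred1_eq.
  move=> z _; rewrite pair_mnmE exprD ![_ == z]eq_sym; congr (_ * _).
    by case: eqP => [->|_]; rewrite ?mul1n ?mul0n.
  by case: eqP => [->|_]; rewrite ?mul1n ?mul0n.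
have oddE x y p q : x != y ->
    [exists z, odd (pair_mnm x y p q z)] = odd p || odd q.
  move=> xNy; apply/existsP/idP => [[z]|/orP[p_odd|q_odd]].
  - rewrite pair_mnmE; case: (x == z); case: (y == z);
      by rewrite ?mul1n ?mul0n ?addn0 ?oddD; case: (odd p).
  - by exists x; rewrite pair_mnm_l.
  by exists y; rewrite pair_mnm_r.
have /power_squarefree_idealP/(_ (U_(i) *+ n)%MM) : f \in I.
  apply: inj => //; apply/power_squarefree_idealP => m m_std.
  have Lf_homog : linear_form a * f \is n.+1.-homog.
    by rewrite -add1n dhomogM // linear_form_homog.
  have [m_n|] := eqVneq (mdeg m) n.+1; last exact: dhomog_nemf_coeff.
  have /andP[/forallP m_k _] := m_std.
  rewrite dE in m_std; have [x [y [xNy mE]]] := standard3_pair r_gt1 m_std.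
  have := m_n; rewrite mE mdeg_pair_mnm.
  have := m_k x; have := m_k y; rewrite kE.
  (* Each exponent is at most [n] and they add up to [n.+1], so neither is 0. *)
  case: (m x) => [|p]; [lia|]; case: (m y) => [|q]; [lia|] => _ _ pq_n.
  rewrite mcoeff_linear_formM_pair // !fE ?mdeg_pair_mnm; [|lia|lia].
  rewrite /u !oddE // !prodE /=.
  have signE : (-1) ^+ (odd p || ~~ odd q) = - (-1) ^+ (~~ odd p || odd q) :> K.
    have [n_odd|n_even] := boolP (odd n).
      have N11 : -1 = 1 :> K by rewrite -[RHS]signn -signr_odd n_odd.
      by rewrite N11 !expr1n N11.
    have -> : odd q = ~~ odd p by lia.
    by rewrite negbK !orbb signrN opprK.
  by rewrite signE !exprS; ring.
(* The coefficient of [f] here is [a i ^+ n] up to sign, hence nonzero. *)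
rewrite dE kE standard_power //= fE ?mdegMn ?mdeg1 ?mul1n // => /(_ isT)/eqP.
have [l iNl] := neq_ord i r_gt1.
rewrite /u -(pair_mnmp0 i l) prodE mulr1 mulf_eq0 signr_eq0 /=.
by rewrite expf_eq0 (negPf a_i) andbF.
Qed.

(* The weights annihilate the image of L on the x_i^p x_l^q with p, q > 0; only
   the boundary terms, from pure powers, survive. *)
Lemma mcoeff_linear_formM_telescope a f n i l : i != l ->
  \sum_(p < n) (-1) ^+ p * a i ^+ (n - p.+1) * a l ^+ p *
     (linear_form a * f)@_(pair_mnm i l p.+1 (n - p)) =
  a i ^+ n * f@_(U_(l) *+ n)%MM - (-1) ^+ n * a l ^+ n * f@_(U_(i) *+ n)%MM.
Proof.
move=> iNl; pose t p := - ((-1) ^+ p * a i ^+ (n - p) * a l ^+ p *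
                        f@_(pair_mnm i l p (n - p))).
transitivity (t n - t 0%N); last first.
  by rewrite /t subnn subn0 pair_mnmp0 pair_mnm0q !expr0; ring.
rewrite -telescope_sumr // big_mkord; apply: eq_bigr => p _.
have npE : (n - p = (n - p.+1).+1)%N by have := ltn_ord p; lia.
by rewrite /t npE mcoeff_linear_formM_pair // !exprS; ring.
Qed.

(** Among three variables, either two have zero coefficients in the form or two have nonzero ones.
    Each case gives a monomial [pair_mnm x y n 1] outside the image. *)
Lemma not_surjective_at3 a n : (2 < r)%N -> d = 3%N -> k = n.+1 ->
  (-1) ^+ n = 1 :> K -> (0 < n)%N -> ~ surjective_at I a n.
Proof.
move=> r_gt2 dE kE signn n_gt0 surj.
have surj_pair x y : x != y -> exists f, forall p q i l, i != l ->
    (p < k)%N -> (q < k)%N ->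
    (linear_form a * f)@_(pair_mnm i l p q)
      = (pair_mnm x y n 1 == pair_mnm i l p q)%:R.
  move=> xNy.
  have [|f _ /power_squarefree_idealP Lf] := surj 'X_[pair_mnm x y n 1].
    by rewrite dhomogX /= mdeg_pair_mnm addn1.
  exists f => p q i l iNl p_k q_k; apply/eqP.
  rewrite -subr_eq0 -mcoeffX -mcoeffB.
  by rewrite Lf // standard_pair ?dE.
have two_zeros x y : x != y -> ~ (a x = 0 /\ a y = 0).
  move=> xNy [ax0 ay0]; have [f fE] := surj_pair x y xNy.
  have := fE n 1%N x y xNy; rewrite eqxx kE.
  case: n n_gt0 {signn surj surj_pair fE} kE => // n' _ _ /(_ _ _)/eqP.
  rewrite mcoeff_linear_formM_pair // ax0 ay0 !mul0r addr0 eq_sym oner_eq0.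
  by move=> /(_ (ltnSn _) isT).
(* The target lies on the line of [l] and [i] only. Its weighted sums along [l j] and [i j] vanish,
   while the one along [l i] keeps its last term. *)
have nonzeros l i j : l != i -> l != j -> i != j -> ~ (a i != 0 /\ a j != 0).
  move=> lNi lNj iNj [ai0 aj0]; have [f fE] := surj_pair l i lNi.
  have Tli := mcoeff_linear_formM_telescope a f n lNi.
  have Tlj := mcoeff_linear_formM_telescope a f n lNj.
  have Tij := mcoeff_linear_formM_telescope a f n iNj.
  rewrite signn in Tli Tlj Tij.
  rewrite big1 in Tlj; last first.
    move=> p _; rewrite fE //; [|have := ltn_ord p; lia..].
    case: eqP => [/mnmP/(_ i)|_]; last by rewrite mulr0.
    by rewrite pair_mnm_r // pair_mnmE (negPf lNi) eq_sym (negPf iNj).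
  rewrite big1 in Tij; last first.
    move=> p _; rewrite fE //; [|have := ltn_ord p; lia..].
    case: eqP => [/mnmP/(_ l)|_]; last by rewrite mulr0.
    rewrite pair_mnm_l // pair_mnmE ![_ == l]eq_sym (negPf lNi) (negPf lNj).
    by lia.
  case: n n_gt0 kE {signn surj surj_pair} fE Tli Tlj Tij => // n' _ kE fE.
  rewrite big_ord_recr /= big1 => [|p _]; last first.
    rewrite fE //; [|have := ltn_ord p; lia..].
    case: eqP => [/mnmP/(_ i)|_]; last by rewrite mulr0.
    by rewrite !pair_mnm_r //; have := ltn_ord p; lia.
  rewrite add0r subnn subSnn fE ?kE // eqxx expr0 !mulr1 !mul1r => Tli Tlj Tij.
  (* The boundary terms cancel in [a i ^+ n * Tlj - a l ^+ n * Tij = a j ^+ n * Tli], read for the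
     right-hand sides with [n = n'.+1]. *)
  have : (-1) ^+ n' * a i ^+ n' * a j ^+ n'.+1 = 0.
    transitivity (a i ^+ n'.+1 * 0 - a l ^+ n'.+1 * 0 : K); last by ring.
    by rewrite {1}Tlj Tij Tli; ring.
  by move/eqP; rewrite !mulf_eq0 signr_eq0 !expf_eq0 (negPf ai0) (negPf aj0)
    !andbF.
pose x0 := Ordinal (ltnW (ltnW r_gt2)).
pose x1 := Ordinal (ltnW r_gt2).
pose x2 := Ordinal r_gt2.
have [a0|a0] := eqVneq (a x0) 0.
  have [a1|a1] := eqVneq (a x1) 0; first exact: (two_zeros x0 x1).
  have [a2|a2] := eqVneq (a x2) 0; first exact: (two_zeros x0 x2).
  exact: (nonzeros x0 x1 x2).
have [a1|a1] := eqVneq (a x1) 0; last exact: (nonzeros x2 x0 x1).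
have [a2|a2] := eqVneq (a x2) 0; first exact: (two_zeros x1 x2).
exact: (nonzeros x1 x0 x2).
Qed.

End Maps.

End LinearForms.


(* In (b), 3 <= r says that squarefree monomials of degree d = 3 exist. For
   r <= 2 the ring is K[x] / (x^k) or K[x, y] / (x^k, y^k), which has the
   weak Lefschetz property for every k and K, so (b) would fail. *)
Theorem theorem3p3 (K : fieldType) (r k d : nat)
    (r_gt0 : (0 < r)%N) (k_gt0 : (0 < k)%N) (d_gt0 : (0 < d)%N) :
  (d = 2 -> weak_lefschetz (power_squarefree_ideal K r k_gt0 d_gt0))
  /\ (d = 3 -> (2 <= k)%N -> (3 <= r)%N ->
       (2%N \in [pchar K]%R ->
          ~ weak_lefschetz (power_squarefree_ideal K r k_gt0 d_gt0))
       /\ (2%N \notin [pchar K]%R ->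
          (weak_lefschetz (power_squarefree_ideal K r k_gt0 d_gt0)
             <-> ~~ odd k))).
Proof.
split=> [dE|dE k_gt1 r_gt2].
  apply/weak_lefschetzP; exists (fun=> 1%R) => j.
  have [j_k|k_j] := ltnP j.+1 k; first by left; apply: injective_at2.
  by right; apply: surjective_at2.
have r_gt1 := ltnW r_gt2.
have not_wlp : ((-1) ^+ k.-1 = 1 :> K)%R ->
    ~ weak_lefschetz (power_squarefree_ideal K r k_gt0 d_gt0).
  move=> sign_k /weak_lefschetzP[a /(_ k.-1)[]].
    by apply: not_injective_at3; rewrite ?prednK //; lia.
  by apply: not_surjective_at3; rewrite ?prednK //; lia.
split=> [char2|char_n2].
  by apply: not_wlp; rewrite GRing.oppr_pchar2 // GRing.expr1n.
split=> [wlp|k_even].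
  apply/negP => k_odd; apply: not_wlp wlp.
  by rewrite -GRing.signr_odd (_ : odd k.-1 = false) //; lia.
apply/weak_lefschetzP; exists (fun=> 1%R) => j.
(* The critical degree [j = k - 1] is on the injective side, unlike for [d = 2]. *)
have [j_k|k_j] := ltnP j k; last by right; apply: surjective_at3.
by left; apply: injective_at3.
Qed.
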